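(* Let $N_1,N_2$ be positive integers, $a>b>c>0$, $0<\delta<\pi$, and $$f_1(n)=\sqrt{\frac{a-c}{\cos(\delta/2)}}\sin(\delta n),\qquad f_2(n)=\sqrt{\frac{a-c}{\cos(\delta/2)}}\cos(\delta n).$$ For $i=1,2$ let $g_i:\{n\in\frac12\mathbb Z:-N_i\le n\le N_i\}\to\mathbb R$ be solutions of the recurrence relations $$g_1(n)\,g_1(n+\tfrac12)=a-b-f_1(n)f_1(n+\tfrac12),\qquad g_2(n)\,g_2(n+\tfrac12)=f_2(n)f_2(n+\tfrac12)-a+b$$ (for all $n$ with $n,n+\frac12$ in the respective domain). Then $g_1$ and $g_2$ satisfy the boundary conditions $$g_1(\pm N_1)=0,\qquad g_2(\pm N_2)=0$$ and do not change their signs on their respective domains, if $$\frac{a-2b+c}{a-c}=-\frac{\cos\frac{(4N_1-1)\pi}{4N_1+4N_2-2}}{\cos\frac{\pi}{4N_1+4N_2-2}}=\frac{\cos\frac{(4N_2-1)\pi}{4N_1+4N_2-2}}{\cos\frac{\pi}{4N_1+4N_2-2}}$$ and $$\delta=\frac{\pi}{2N_1+2N_2-1}.$$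
   Context: Here $\frac12\mathbb Z$ denotes the set of integers and half-integers. ''Does not change its sign'' means that no two values of the function have opposite strict signs. *)

(* Defs.v *)
From Stdlib Require Import Reals.
Open Scope R_scope.

Definition half_integer (n : R) : Prop := exists k : Z, n = IZR k / 2.

(* A function on the half-integers of [-N, N] is represented by a function
   [R -> R] whose values outside [half_range N] are never referred to. *)
Definition half_range (N : nat) (n : R) : Prop :=
  half_integer n /\ - INR N <= n <= INR N.

Definition f1 (a c delta n : R) : R :=
  sqrt ((a - c) / cos (delta / 2)) * sin (delta * n).

Definition f2 (a c delta n : R) : R :=
  sqrt ((a - c) / cos (delta / 2)) * cos (delta * n).

Definition g1_recurrence (a b c delta : R) (N : nat) (g : R -> R) : Prop :=
  forall n : R, half_range N n -> half_range N (n + 1 / 2) ->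
    g n * g (n + 1 / 2)
    = a - b - f1 a c delta n * f1 a c delta (n + 1 / 2).

Definition g2_recurrence (a b c delta : R) (N : nat) (g : R -> R) : Prop :=
  forall n : R, half_range N n -> half_range N (n + 1 / 2) ->
    g n * g (n + 1 / 2)
    = f2 a c delta n * f2 a c delta (n + 1 / 2) - a + b.

Definition no_sign_change (N : nat) (g : R -> R) : Prop :=
  forall m n : R, half_range N m -> half_range N n -> ~ (g m < 0 /\ 0 < g n).

(* Main.v *)
Require Import Defs.
From Stdlib Require Import Reals.
From Stdlib Require Import Lra Lia ZArith.
Open Scope R_scope.

(** Write [y = delta * (2 * N - 1 / 2)], with [N] one of [N1] and [N2].  By the
    product-to-sum formulas, and because [delta / 2] is the angle
    [PI / (4 * N1 + 4 * N2 - 2)], the hypotheses on [a], [b], [c] turn both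
    recurrences into the same one:
    [g n * g (n + 1 / 2) = K * (cos (delta * (2 * n + 1 / 2)) - cos y)]
    with [K = (a - c) / cos (delta / 2) / 2 > 0]
    ([g1_recurrence_cos], [g2_recurrence_cos]).

    As [n] runs through the half-integers from [- N] to [N - 1 / 2], the angle
    [delta * (2 * n + 1 / 2)] runs through [[- y, y]], reaching [- y] and [y]
    exactly at the two ends; and [y <= PI] because both [N1] and [N2] are
    positive.  Since [cos] is even and decreases on [[0, PI]], the product
    [g n * g (n + 1 / 2)] vanishes at the two ends and is positive everywhere
    else.  Positivity makes all interior values nonzero and of the same sign,
    so that the two vanishing products can only come from the boundary values
    ([zero_ends_same_sign]). *)

(** Consecutive products determine the signs: the interior terms
    [h 1, ..., h (L - 1)] are linked by positive products, hence are nonzero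
    with a common sign; a zero product at an end must then be the fault of the
    end term.  [3 <= L] provides at least one positive product, without which
    [h 1] could vanish instead of [h 0]. *)
Lemma zero_ends_same_sign (h : nat -> R) (L : nat) :
  (3 <= L)%nat ->
  h 0%nat * h 1%nat = 0 ->
  h (L - 1)%nat * h L = 0 ->
  (forall j, (0 < j)%nat -> (S j < L)%nat -> 0 < h j * h (S j)) ->
  h 0%nat = 0 /\ h L = 0 /\
  forall i j, (i <= L)%nat -> (j <= L)%nat -> 0 <= h i * h j.
Proof.
  intros HL H0 HL0 Hpos.
  assert (Hone : h 1%nat <> 0).
  { intro E. assert (H := Hpos 1%nat ltac:(lia) ltac:(lia)).
    rewrite E in H. lra. }
  assert (Hlink : forall j, (0 < j)%nat -> (j < L)%nat -> 0 < h 1%nat * h j).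
  { induction j as [|j IH]; [lia|]. intros _ Hj.
    destruct (Nat.eq_dec j 0) as [->|Hj0].
    - nra.
    - assert (P := IH ltac:(lia) ltac:(lia)).
      assert (Q := Hpos j ltac:(lia) ltac:(lia)).
      destruct (Rtotal_order (h j) 0) as [Hn|[Hz|Hp]]; [nra| |nra].
      rewrite Hz in P. lra. }
  assert (Z0 : h 0%nat = 0).
  { destruct (Rmult_integral _ _ H0); [assumption|contradiction]. }
  assert (ZL : h L = 0).
  { destruct (Rmult_integral _ _ HL0) as [E|E]; [|exact E].
    assert (P := Hlink (L - 1)%nat ltac:(lia) ltac:(lia)).
    rewrite E in P. lra. }
  split; [exact Z0|split; [exact ZL|]].
  assert (Hweak : forall j, (j <= L)%nat -> 0 <= h 1%nat * h j).
  { intros j Hj. destruct (Nat.eq_dec j 0) as [->|Hj0]; [rewrite Z0; lra|].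
    destruct (Nat.eq_dec j L) as [->|HjL]; [rewrite ZL; lra|].
    assert (P := Hlink j ltac:(lia) ltac:(lia)). lra. }
  intros i j Hi Hj.
  assert (P := Hweak i Hi). assert (Q := Hweak j Hj).
  destruct (Rtotal_order (h 1%nat) 0) as [Hn|[Hz|Hp]]; [|contradiction|].
  - assert (h i <= 0) by nra. assert (h j <= 0) by nra. nra.
  - assert (0 <= h i) by nra. assert (0 <= h j) by nra. nra.
Qed.

Lemma cos_lt_of_Rabs_lt (x y : R) : Rabs x < y -> y <= PI -> cos y < cos x.
Proof.
  intros Hxy Hy. assert (H0 := Rabs_pos x).
  assert (E : cos x = cos (Rabs x)).
  { unfold Rabs. destruct (Rcase_abs x); [symmetry; apply cos_neg|reflexivity]. }
  rewrite E. apply cos_decreasing_1; lra.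
Qed.

Lemma half_range_index (N : nat) (n : R) :
  half_range N n ->
  exists j : nat, (j <= 4 * N)%nat /\ n = - INR N + INR j / 2.
Proof.
  intros [[k Hk] [Hl Hu]].
  assert (Hkl : (- 2 * Z.of_nat N <= k)%Z).
  { apply le_IZR. rewrite mult_IZR, <- INR_IZR_INZ. lra. }
  assert (Hku : (k <= 2 * Z.of_nat N)%Z).
  { apply le_IZR. rewrite mult_IZR, <- INR_IZR_INZ. lra. }
  exists (Z.to_nat (k + 2 * Z.of_nat N)). split; [lia|].
  rewrite (INR_IZR_INZ (Z.to_nat _)), Z2Nat.id by lia.
  rewrite plus_IZR, mult_IZR, <- INR_IZR_INZ. lra.
Qed.

Lemma half_range_of_index (N j : nat) :
  (j <= 4 * N)%nat -> half_range N (- INR N + INR j / 2).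
Proof.
  intros Hj. split.
  - exists (Z.of_nat j - 2 * Z.of_nat N)%Z.
    rewrite minus_IZR, mult_IZR, <- !INR_IZR_INZ. lra.
  - apply le_INR in Hj. rewrite mult_INR in Hj. simpl (INR 4) in Hj.
    assert (H := pos_INR j). lra.
Qed.

(** The common form of the two recurrences forces the boundary zeros: along
    [n = - N + j / 2] with [0 <= j < 4 * N], the angle
    [delta * (2 * n + 1 / 2)] is symmetric about [0] and its absolute value is
    [delta * (2 * N - 1 / 2)] only for [j = 0] and [j = 4 * N - 1]. *)
Lemma cos_recurrence_zero_ends (N : nat) (delta K : R) (g : R -> R) :
  (0 < N)%nat -> 0 < delta -> delta * (2 * INR N - 1 / 2) <= PI -> 0 < K ->
  (forall n, half_range N n -> half_range N (n + 1 / 2) ->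
     g n * g (n + 1 / 2)
     = K * (cos (delta * (2 * n + 1 / 2)) - cos (delta * (2 * INR N - 1 / 2)))) ->
  g (- INR N) = 0 /\ g (INR N) = 0 /\ no_sign_change N g.
Proof.
  intros HN Hd Hpi HK Hrec.
  set (h := fun j : nat => g (- INR N + INR j / 2)).
  assert (Hh : forall j, (j < 4 * N)%nat ->
    h j * h (S j) = K * (cos (delta * (INR j + 1 / 2 - 2 * INR N))
                         - cos (delta * (2 * INR N - 1 / 2)))).
  { intros j Hj. unfold h.
    assert (E : - INR N + INR (S j) / 2 = (- INR N + INR j / 2) + 1 / 2)
      by (rewrite S_INR; lra).
    rewrite E, Hrec.
    - do 3 f_equal. lra.
    - apply half_range_of_index. lia.
    - rewrite <- E. apply half_range_of_index. lia. }
  destruct (zero_ends_same_sign h (4 * N)) as [Z0 [ZL Hsign]].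
  - lia.
  - rewrite Hh by lia.
    replace (delta * (INR 0 + 1 / 2 - 2 * INR N))
      with (- (delta * (2 * INR N - 1 / 2))) by (simpl; lra).
    rewrite cos_neg. ring.
  - assert (H := Hh (4 * N - 1)%nat ltac:(lia)).
    replace (S (4 * N - 1)) with (4 * N)%nat in H by lia.
    assert (E : INR (4 * N - 1) = 4 * INR N - 1)
      by (rewrite minus_INR, mult_INR by lia; simpl; lra).
    rewrite H, E.
    replace (4 * INR N - 1 + 1 / 2 - 2 * INR N)
      with (2 * INR N - 1 / 2) by lra.
    ring.
  - intros j Hj HjL. rewrite Hh by lia.
    apply Rmult_lt_0_compat; [exact HK|]. apply Rlt_0_minus.
    apply cos_lt_of_Rabs_lt; [|exact Hpi].
    apply lt_INR in Hj. apply lt_INR in HjL.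
    rewrite mult_INR, S_INR in HjL. simpl (INR 4) in HjL. simpl (INR 0) in Hj.
    apply Rabs_def1.
    + apply Rmult_lt_compat_l; lra.
    + rewrite Ropp_mult_distr_r. apply Rmult_lt_compat_l; lra.
  - split; [|split].
    + rewrite <- Z0. unfold h. f_equal. simpl. lra.
    + rewrite <- ZL. unfold h. f_equal. rewrite mult_INR. simpl (INR 4). lra.
    + intros m n Hm Hn [Hgm Hgn].
      destruct (half_range_index N m Hm) as [i [Hi Ei]].
      destruct (half_range_index N n Hn) as [j [Hj Ej]].
      assert (H := Hsign i j Hi Hj). unfold h in H.
      rewrite <- Ei, <- Ej in H. nra.
Qed.

Section CosineForm.

Variables a b c delta : R.
Hypothesis Hac : c < a.
Hypothesis Hdelta : 0 < delta < PI.

Lemma cos_half_pos : 0 < cos (delta / 2).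
Proof. apply cos_gt_0; lra. Qed.

Let K := (a - c) / cos (delta / 2) / 2.

Lemma amplitude_pos : 0 < (a - c) / cos (delta / 2).
Proof. apply Rdiv_lt_0_compat; [lra|exact cos_half_pos]. Qed.

Lemma amplitude_cos_half : K * cos (delta / 2) = (a - c) / 2.
Proof. unfold K. field. assert (H := cos_half_pos). lra. Qed.

Lemma f1_mul_f1 (n : R) :
  f1 a c delta n * f1 a c delta (n + 1 / 2)
  = (a - c) / 2 - K * cos (delta * (2 * n + 1 / 2)).
Proof.
  rewrite <- amplitude_cos_half. unfold K, f1.
  assert (E := sqrt_sqrt _ (Rlt_le _ _ amplitude_pos)).
  replace (delta * (2 * n + 1 / 2))
    with (delta * n + delta * (n + 1 / 2)) by lra.
  (* The first three occurrences belong to the amplitudes. *)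
  replace (cos (delta / 2))
    with (cos (delta * (n + 1 / 2) - delta * n)) at 4 by (f_equal; lra).
  rewrite cos_plus, cos_minus.
  set (s := sqrt _) in *. rewrite <- E. lra.
Qed.

Lemma f2_mul_f2 (n : R) :
  f2 a c delta n * f2 a c delta (n + 1 / 2)
  = (a - c) / 2 + K * cos (delta * (2 * n + 1 / 2)).
Proof.
  rewrite <- amplitude_cos_half. unfold K, f2.
  assert (E := sqrt_sqrt _ (Rlt_le _ _ amplitude_pos)).
  replace (delta * (2 * n + 1 / 2))
    with (delta * n + delta * (n + 1 / 2)) by lra.
  (* The first three occurrences belong to the amplitudes. *)
  replace (cos (delta / 2))
    with (cos (delta * (n + 1 / 2) - delta * n)) at 4 by (f_equal; lra).
  rewrite cos_plus, cos_minus.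
  set (s := sqrt _) in *. rewrite <- E. lra.
Qed.

(** After the product-to-sum formulas the constant terms of the two recurrences
    are [(a - 2 * b + c) / 2] and its opposite; this writes them in the unit [K]
    of the oscillating term, so that the two can be combined. *)
Lemma balance_of_ratio (r : R) :
  (a - 2 * b + c) / (a - c) = r / cos (delta / 2) ->
  (a - 2 * b + c) / 2 = K * r.
Proof.
  intros H. assert (P := cos_half_pos).
  replace (a - 2 * b + c) with ((a - 2 * b + c) / (a - c) * (a - c))
    by (field; lra).
  rewrite H. unfold K. field. lra.
Qed.

Lemma g1_recurrence_cos (N : nat) (g : R -> R) (y : R) :
  g1_recurrence a b c delta N g ->
  (a - 2 * b + c) / (a - c) = - (cos y / cos (delta / 2)) ->
  forall n, half_range N n -> half_range N (n + 1 / 2) ->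
  g n * g (n + 1 / 2) = K * (cos (delta * (2 * n + 1 / 2)) - cos y).
Proof.
  intros Hg Hr n Hn Hn'. rewrite (Hg n Hn Hn'), f1_mul_f1.
  rewrite <- Rdiv_opp_l in Hr. apply balance_of_ratio in Hr. lra.
Qed.

Lemma g2_recurrence_cos (N : nat) (g : R -> R) (y : R) :
  g2_recurrence a b c delta N g ->
  (a - 2 * b + c) / (a - c) = cos y / cos (delta / 2) ->
  forall n, half_range N n -> half_range N (n + 1 / 2) ->
  g n * g (n + 1 / 2) = K * (cos (delta * (2 * n + 1 / 2)) - cos y).
Proof.
  intros Hg Hr n Hn Hn'. rewrite (Hg n Hn Hn'), f2_mul_f2.
  apply balance_of_ratio in Hr. lra.
Qed.

End CosineForm.

Theorem theorem6p1 (N1 N2 : nat) (a b c delta : R) (g1 g2 : R -> R)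
  (hN1 : (0 < N1)%nat) (hN2 : (0 < N2)%nat)
  (hab : a > b) (hbc : b > c) (hc : c > 0)
  (hdelta : 0 < delta < PI)
  (hg1 : g1_recurrence a b c delta N1 g1)
  (hg2 : g2_recurrence a b c delta N2 g2)
  (habc1 : (a - 2 * b + c) / (a - c)
     = - (cos ((4 * INR N1 - 1) * PI / (4 * INR N1 + 4 * INR N2 - 2))
          / cos (PI / (4 * INR N1 + 4 * INR N2 - 2))))
  (habc2 : (a - 2 * b + c) / (a - c)
     = cos ((4 * INR N2 - 1) * PI / (4 * INR N1 + 4 * INR N2 - 2))
       / cos (PI / (4 * INR N1 + 4 * INR N2 - 2)))
  (hdelta_eq : delta = PI / (2 * INR N1 + 2 * INR N2 - 1)) :
  (g1 (- INR N1) = 0 /\ g1 (INR N1) = 0 /\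
   g2 (- INR N2) = 0 /\ g2 (INR N2) = 0) /\
  no_sign_change N1 g1 /\ no_sign_change N2 g2.
Proof.
  assert (H1 : 1 <= INR N1) by (apply (le_INR 1); lia).
  assert (H2 : 1 <= INR N2) by (apply (le_INR 1); lia).
  assert (Hac : c < a) by lra.
  assert (Hhalf : PI / (4 * INR N1 + 4 * INR N2 - 2) = delta / 2)
    by (rewrite hdelta_eq; field; lra).
  assert (Hangle : forall x,
    (4 * x - 1) * PI / (4 * INR N1 + 4 * INR N2 - 2) = delta * (2 * x - 1 / 2))
    by (intro x; rewrite hdelta_eq; field; lra).
  assert (HPI : PI = delta * (2 * INR N1 + 2 * INR N2 - 1))
    by (rewrite hdelta_eq; field; lra).
  rewrite Hhalf, Hangle in habc1, habc2.
  assert (HK : 0 < (a - c) / cos (delta / 2) / 2).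
  { apply Rdiv_lt_0_compat; [apply amplitude_pos; assumption|lra]. }
  destruct (cos_recurrence_zero_ends N1 delta _ g1 hN1 (proj1 hdelta)
    ltac:(rewrite HPI; apply Rmult_le_compat_l; lra) HK
    (g1_recurrence_cos a b c delta Hac hdelta N1 g1 _ hg1 habc1))
    as [L1 [U1 S1]].
  destruct (cos_recurrence_zero_ends N2 delta _ g2 hN2 (proj1 hdelta)
    ltac:(rewrite HPI; apply Rmult_le_compat_l; lra) HK
    (g2_recurrence_cos a b c delta Hac hdelta N2 g2 _ hg2 habc2))
    as [L2 [U2 S2]].
  tauto.
Qed.
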